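(* Let $S$ be a sidigraph with $n$ vertices and $a=a^++a^-$ arcs, and let $z_1,z_2,\dots,z_n$ be its eigenvalues. Then $$E(S)\le\sqrt{\tfrac12\,n\,(a+c_2^+-c_2^-)}.$$
   Context: A sidigraph (signed digraph) is a pair $S=(D,\sigma)$, where $D=(V,\mathscr{A})$ is a digraph and $\sigma:\mathscr{A}\to\{-1,1\}$. $a^+$ and $a^-$ are the numbers of positive and negative arcs of $S$. Its adjacency matrix $A(S)=(a_{ij})$ has $a_{ij}=\sigma(v_i,v_j)$ if there is an arc from $v_i$ to $v_j$ and $0$ otherwise; the eigenvalues of $S$ are those of $A(S)$ (with multiplicity), and the energy is $E(S)=\sum_{j=1}^n|\Re z_j|$. The sign of a walk is the product of the signs of its arcs. $c_2^+$ and $c_2^-$ denote the numbers of positive and negative closed walks of length $2$ in $S$, closed walks being counted with their starting vertex (i.e. summed over all vertices $v_i$ of walks from $v_i$ to $v_i$). *)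

(* Defs.v *)
From mathcomp Require Import all_boot all_order all_algebra.
From mathcomp Require Import reals.
From mathcomp Require Import complex.

Set Implicit Arguments.
Unset Strict Implicit.
Unset Printing Implicit Defensive.

Import GRing.Theory Num.Theory.
Local Open Scope ring_scope.

(* The values of [sign] outside [arcs] are irrelevant: every notion below only
   looks at [sign] on arcs. Loops are allowed. *)
Record sidigraph (n : nat) := Sidigraph {
  arcs : {set 'I_n * 'I_n};
  sign : 'I_n * 'I_n -> int;
  signP : forall e, e \in arcs -> sign e = 1 \/ sign e = -1
}.

Definition pos_arcs n (S : sidigraph n) : nat :=
  #|[set e in arcs S | sign S e == 1]|.

Definition neg_arcs n (S : sidigraph n) : nat :=
  #|[set e in arcs S | sign S e == -1]|.

Definition adjacency (R : realType) n (S : sidigraph n) : 'M[R[i]]_n :=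
  \matrix_(i, j) if (i, j) \in arcs S then (sign S (i, j))%:~R else 0.

(* The roots, with multiplicity, of the characteristic polynomial. *)
Definition eigenvalues (R : realType) n (S : sidigraph n) : seq R[i] :=
  sval (closed_field_poly_normal (char_poly (adjacency R S))).

Definition energy (R : realType) n (S : sidigraph n) : R :=
  \sum_(z <- eigenvalues R S) `|complex.Re z|.

(* A walk of length k is its list of k + 1 successive vertices. *)
Definition step n k (w : k.+1.-tuple 'I_n) (i : 'I_k) : 'I_n * 'I_n :=
  (tnth w (widen_ord (leqnSn k) i), tnth w (lift ord0 i)).

Definition closed_walks n (S : sidigraph n) (k : nat) :
    {set k.+1.-tuple 'I_n} :=
  [set w : k.+1.-tuple 'I_n | [forall i : 'I_k, step w i \in arcs S]
                              && (tnth w ord0 == tnth w ord_max)].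

Definition walk_sign n (S : sidigraph n) k (w : k.+1.-tuple 'I_n) : int :=
  \prod_(i < k) sign S (step w i).

Definition pos_closed_walks n (S : sidigraph n) (k : nat) : nat :=
  #|[set w in closed_walks S k | walk_sign S w == 1]|.

Definition neg_closed_walks n (S : sidigraph n) (k : nat) : nat :=
  #|[set w in closed_walks S k | walk_sign S w == -1]|.

Lemma char_poly_eigenvalues (R : realType) n (S : sidigraph n) :
  char_poly (adjacency R S) = \prod_(z <- eigenvalues R S) ('X - z%:P).
Proof.
rewrite /eigenvalues; case: closed_field_poly_normal => r /= {1}->.
by rewrite (monicP (char_poly_monic _)) scale1r.
Qed.

Lemma size_eigenvalues (R : realType) n (S : sidigraph n) :
  size (eigenvalues R S) = n.
Proof.
have := size_char_poly (adjacency R S).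
by rewrite char_poly_eigenvalues size_prod_XsubC => -[].
Qed.

(* Main.v *)
(** Since 2 (Re z)^2 = |z|^2 + Re (z^2), Cauchy-Schwarz reduces the bound to
    estimating the sums of |z|^2 and of z^2 over the spectrum. A Schur
    triangularization of the adjacency matrix A shows that the first is at most
    the sum of the |A i j|^2, which is the number of arcs, and that the second
    is the trace of A^2, which is c_2^+ - c_2^-. *)
Require Import Defs.
From mathcomp Require Import all_boot all_order all_algebra.
From mathcomp Require Import reals.
From mathcomp Require Import complex.
From mathcomp Require Import ring.

Local Open Scope ring_scope.

Import Order.TTheory GRing.Theory Num.Theory.
Local Open Scope sesquilinear_scope.

Set Implicit Arguments.
Unset Strict Implicit.
Unset Printing Implicit Defensive.

(** Cauchy-Schwarz against the constant family 1: both sides become double sums over [s], compared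
    termwise by [f x * f y <= (f x ^+ 2 + f y ^+ 2) / 2]. *)
Lemma sqr_sum_le (R : realFieldType) (I : Type) (s : seq I) (f : I -> R) :
  (\sum_(x <- s) f x) ^+ 2 <= (size s)%:R * \sum_(x <- s) f x ^+ 2.
Proof.
have cst (c : R) : \sum_(x <- s) c = c *+ size s 
  by rewrite big_const_seq count_predT iter_addr_0.
have -> : (size s)%:R * \sum_(x <- s) f x ^+ 2 =
    \sum_(x <- s) \sum_(y <- s) (f x ^+ 2 + f y ^+ 2) / 2.
  under [RHS]eq_bigr => x _ do rewrite -mulr_suml big_split /= cst.
  rewrite -mulr_suml big_split /= cst -sumrMnl -mulr2n sumrMnl.
  by rewrite -[_ *+ 2]mulr_natr mulfK ?pnatr_eq0 // mulr_natl.
rewrite expr2 mulr_suml; apply: ler_sum => x _.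
by rewrite mulr_sumr; apply: ler_sum => y _; rewrite leif_mean_square.
Qed.

Section SchurForm.
Variable C : numClosedFieldType.
Implicit Types (n : nat) (s : seq C).

Lemma Schur_form n (A : 'M[C]_n) :
  exists2 P : 'M[C]_n, P \is unitarymx & is_trig_mx (P *m A *m P^t*).
Proof.
(* [Schur] needs a positive dimension; for the empty matrix both conditions are vacuous. *)
have [n_gt0|] := ltnP 0 n; last first.
  rewrite leqn0 => /eqP n0; subst n; exists 1%:M.
    by apply/unitarymxP/matrixP => -[].
  by apply/is_trig_mxP => -[].
by have [P Pu Ptrig] := Schur A n_gt0; exists P => //; rewrite -conjymx.
Qed.

Lemma char_poly_unitary_conj n (P A : 'M[C]_n) : P \is unitarymx ->
  char_poly (P *m A *m P^t*) = char_poly A.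
Proof.
move=> Pu; have PP := unitarymxP Pu.
pose Q := map_mx polyC P; pose Q' := map_mx polyC (P^t*).
have QQ : Q *m Q' = 1%:M by rewrite -map_mxM PP map_mx1.
rewrite /char_poly.
(* The similarity lifts to polynomial matrices: the scalar matrix of ['X] commutes with [Q], and
   [Q *m Q'] is the identity. *)
have -> : char_poly_mx (P *m A *m P^t*) =
    Q *m char_poly_mx A *m Q'.
  by rewrite /char_poly_mx !map_mxM mulmxBr mulmxBl scalar_mxC
    -(mulmxA _%:M) QQ mulmx1.
by rewrite !det_mulmx mulrAC -det_mulmx QQ det1 mul1r.
Qed.

Lemma mxtrace_unitary_conj n (A P : 'M[C]_n) : P \is unitarymx ->
  \tr (P *m A *m P^t*) = \tr A.
Proof. by move=> Pu; rewrite -mulmxA mxtrace_mulC mulmxKtV. Qed.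

Lemma mul_unitary_conj n (A B P : 'M[C]_n) : P \is unitarymx ->
  (P *m A *m P^t*) *m (P *m B *m P^t*) = P *m (A *m B) *m P^t*.
Proof. by move=> Pu; rewrite !mulmxA mulmxKtV. Qed.

(** [s] and the diagonal of the triangular form both give the roots of the same characteristic
    polynomial, so they agree up to permutation. A general [f] covers both the squares and the
    squared moduli. *)
Lemma big_eigenvalues_diag n (A P : 'M[C]_n) s (V : nmodType) (f : C -> V) :
  P \is unitarymx -> is_trig_mx (P *m A *m P^t*) ->
  char_poly A = \prod_(z <- s) ('X - z%:P) ->
  \sum_(z <- s) f z = \sum_i f ((P *m A *m P^t*) i i).
Proof.
move=> Pu Ptrig As.
rewrite -(@big_map _ _ _ _ _ (fun i => (P *m A *m P^t*) i i) _ predT).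
apply: perm_big; apply: prod_XsubC_eq.
by rewrite -As -(char_poly_unitary_conj A Pu) char_poly_trig // big_map.
Qed.

Lemma sum_sqr_eigenvalues n (A : 'M[C]_n) s :
  char_poly A = \prod_(z <- s) ('X - z%:P) ->
  \sum_(z <- s) z ^+ 2 = \tr (A *m A).
Proof.
move=> As; have [P Pu Ptrig] := Schur_form A.
rewrite (big_eigenvalues_diag _ Pu Ptrig As).
rewrite -(mxtrace_unitary_conj _ Pu) -mul_unitary_conj //.
move: Ptrig; move: (P *m A *m P^t*) => T /is_trig_mxP Ttrig.
apply: eq_bigr => i _; rewrite mxE (bigD1 i) //= big1 ?addr0 // => j ji.
(* For [j] distinct from [i], one of [T i j] and [T j i] lies above the diagonal, so the diagonal of
   the square of [T] consists of the squares [T i i ^+ 2]. *)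
by case: (ltngtP i j) => [/Ttrig ->|/Ttrig ->|/val_inj ij];
  rewrite ?mul0r ?mulr0 // ij eqxx in ji *.
Qed.

Lemma mxtrace_mul_trmxC n (A : 'M[C]_n) :
  \tr (A *m A^t*) = \sum_i \sum_j `|A i j| ^+ 2.
Proof.
by apply: eq_bigr => i _; rewrite mxE; apply: eq_bigr => j _; rewrite !mxE normCK.
Qed.

(** The right-hand side is the squared Frobenius norm, which is invariant under unitary conjugation;
    in the triangular form, the eigenvalues account for its diagonal part only. *)
Lemma Schur_inequality n (A : 'M[C]_n) s :
  char_poly A = \prod_(z <- s) ('X - z%:P) ->
  \sum_(z <- s) `|z| ^+ 2 <= \sum_i \sum_j `|A i j| ^+ 2.
Proof.
move=> As; have [P Pu Ptrig] := Schur_form A.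
rewrite (big_eigenvalues_diag _ Pu Ptrig As) -mxtrace_mul_trmxC.
rewrite -(mxtrace_unitary_conj _ Pu) -mul_unitary_conj //.
have -> : P *m A^t* *m P^t* = (P *m A *m P^t*)^t*.
  by rewrite !trmx_mul !map_mxM !trmxCK mulmxA.
rewrite mxtrace_mul_trmxC; apply: ler_sum => i _.
by rewrite (bigD1 i) //= lerDl sumr_ge0 // => j _; rewrite exprn_ge0.
Qed.

End SchurForm.

(** With [z = a + ib], the right-hand side is (a^2 + b^2) + (a^2 - b^2). *)
Lemma sqr_Re_complex (R : rcfType) (z : R[i]) :
  ((complex.Re z) ^+ 2)%:C%C *+ 2 = `|z| ^+ 2 + 'Re (z ^+ 2).
Proof.
rewrite -add_Re2_Im2 -complexRe -rmorphD -rmorphMn; congr (_%:C)%C.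
by case: z => a b /=; rewrite !expr2 mulr2n; ring.
Qed.

Section Sidigraph.
Variables (n : nat) (S : sidigraph n).

Lemma card_arcs : #|arcs S| = (pos_arcs S + neg_arcs S)%N.
Proof.
rewrite -(cardsID [set e | sign S e == 1]) /pos_arcs /neg_arcs; congr (_ + _)%N.
  by apply: eq_card => e; rewrite !inE.
apply: eq_card => e; rewrite !inE andbC; case: (boolP (e \in arcs S)) => //= eS.
by case: (signP eS) => ->.
Qed.

Lemma walk_sign_closed k (w : k.+1.-tuple 'I_n) :
  w \in closed_walks S k -> (walk_sign S w == 1) || (walk_sign S w == -1).
Proof.
rewrite inE => /andP[/forallP wS _].
apply: (big_ind (fun x => (x == 1) || (x == -1))) => //.
  by move=> x y /pred2P[] -> /pred2P[] ->.
by move=> i _; case: (signP (wS i)) => ->.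
Qed.

Lemma sum_walk_sign k :
  \sum_(w in closed_walks S k) walk_sign S w =
    (pos_closed_walks S k)%:R - (neg_closed_walks S k)%:R.
Proof.
rewrite /pos_closed_walks /neg_closed_walks -!sum1_card !natr_sum.
under [X in _ = X - _]eq_bigl do rewrite inE.
under [X in _ = _ - X]eq_bigl do rewrite inE.
rewrite !big_mkcondr /= -sumrB; apply: eq_bigr => w /walk_sign_closed.
by case/pred2P=> ->.
Qed.

Variable R : realType.
Local Notation A := (adjacency R S).

Lemma sum_norm_adjacency :
  \sum_i \sum_j `|A i j| ^+ 2 = (pos_arcs S + neg_arcs S)%:R.
Proof.
rewrite -card_arcs pair_big -sum1_card natr_sum [RHS]big_mkcond /=.
apply: eq_bigr => -[i j] _; rewrite mxE /=; case: ifP => [ijS|_];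
  last by rewrite normr0 expr0n.
by case: (signP ijS) => ->; rewrite ?rmorphN ?normrN normr1 expr1n.
Qed.

Lemma mxtrace_sqr_adjacency :
  \tr (A *m A) = (pos_closed_walks S 2)%:R - (neg_closed_walks S 2)%:R.
Proof.
have -> : (pos_closed_walks S 2)%:R - (neg_closed_walks S 2)%:R =
    (\sum_(w in closed_walks S 2) walk_sign S w)%:~R :> R[i].
  by rewrite sum_walk_sign rmorphB /= !rmorph_nat.
(* A closed walk of length 2 has the form i, j, i, so it is encoded by its first two vertices; a
   loop gives the case i = j. The walk i, j, i then matches the term [A i j * A j i] of the
   trace. *)
pose h (e : 'I_n * 'I_n) := [tuple e.1; e.2; e.1].
rewrite (reindex_onto h (fun w => (tnth w ord0, tnth w (inord 1)))) /=; last first.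
  move=> w; rewrite inE => /andP[_ /eqP]; case/tupleP: w => x w.
  case/tupleP: w => y w; case/tupleP: w => z w.
  rewrite (tuple0 w) !(tnth_nth x) /= inordK //= => ->.
  exact: val_inj.
rewrite rmorph_sum /= /mxtrace.
under [LHS]eq_bigr do rewrite mxE.
rewrite pair_big [RHS]big_mkcond /=; apply: eq_bigr => -[i j] _ /=.
rewrite !mxE inE !(tnth_nth i) inordK //= !eqxx !andbT.
have step0 : step (h (i, j)) ord0 = (i, j) by rewrite /step !(tnth_nth i).
have step1 : step (h (i, j)) (lift ord0 ord0) = (j, i).
  by rewrite /step !(tnth_nth i).
have -> : [forall k, step (h (i, j)) k \in arcs S] =
    ((i, j) \in arcs S) && ((j, i) \in arcs S).
  apply/forallP/andP => [all_steps|[ij ji] k].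
    by rewrite -step0 -step1 !all_steps.
  by case: (unliftP ord0 k) => [l|] ->; rewrite ?(ord1 l) ?step0 ?step1.
rewrite /walk_sign !big_ord_recl big_ord0 step0 step1 mulr1 rmorphM /=.
by case: (_ \in _); case: (_ \in _); rewrite ?mul0r ?mulr0.
Qed.

End Sidigraph.

Theorem theorem5p4 (R : realType) (n : nat) (S : sidigraph n) :
  energy R S <=
    Num.sqrt (1 / 2 * n%:R *
      ((pos_arcs S + neg_arcs S)%:R
       + (pos_closed_walks S 2)%:R - (neg_closed_walks S 2)%:R)).
Proof.
have As := char_poly_eigenvalues R S.
apply: (le_trans (ler_norm _)); rewrite -sqrtr_sqr; apply: ler_wsqrtr.
apply: (le_trans (sqr_sum_le _ _)); rewrite size_eigenvalues.
(* The common factor [n] is cancelled; the factor 1/2 then moves to the left, to form the doubled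
   squares of [sqr_Re_complex], and [lecR] carries the inequality to [R[i]], where the spectral
   lemmas apply. *)
rewrite [leRHS]mulrAC [leRHS]mulrC ler_wpM2l // div1r.
under eq_bigr do rewrite real_normK ?num_real //.
rewrite ler_pdivlMl // mulr_natl -lecR rmorphMn rmorph_sum /= -sumrMnl.
under eq_bigr do rewrite sqr_Re_complex.
rewrite big_split /= -raddf_sum /= (sum_sqr_eigenvalues As)
  mxtrace_sqr_adjacency.
have -> : 'Re ((pos_closed_walks S 2)%:R - (neg_closed_walks S 2)%:R)
    = (pos_closed_walks S 2)%:R - (neg_closed_walks S 2)%:R :> R[i].
  by apply/Creal_ReP; rewrite rpredB // realn.
(* The trace term occurs on both sides; without it, the bound on the squared moduli by the number of
   arcs remains. *)
rewrite -addrA rmorphD rmorphB /= !rmorph_nat lerD2r -(sum_norm_adjacency S R).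
exact: Schur_inequality.
Qed.
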